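(* Let $(M,g)$ be the $4$-dimensional semi-Riemannian manifold with the interior black hole metric $$ds^2 = -\left(\frac{2\xi}{t} - 1\right)^{-1}dt^2 + \left(\frac{2\xi}{t} - 1\right)dz^2 + t^2\left(d\theta^2 + \sin^2 \theta\, d\phi^2\right),$$ where $\xi=\xi(t)$ is a smooth function of $t$. Then $(M,g)$ satisfies the following, where in (i), (ii), (iii), (iv) and (vi) $Z$ is any one of $R, S, C, W, K$ and $P$: (i) $R \cdot Z = L_1\, Q(g, Z)$, with $L_1 = \frac{\xi - t \dot{\xi}}{t^3}$; (ii) $C \cdot Z = L_2\, Q(g, Z)$, with $L_2 = \frac{6 \xi - 4t \dot{\xi} + t^2 \ddot{\xi}}{6 t^3}$; (iii) $W \cdot Z = L_2\, Q(g, Z)$; (iv) $K \cdot Z = L_3\, Q(g, Z)$, with $L_3 = \frac{2\xi + t^2 \ddot{\xi}}{2t^3}$; (v) $P \cdot S = L_1\, Q(g, S)$; (vi) $P \cdot Z = L_1\, Q(g, Z) - \frac{1}{3}Q(S, Z)$.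
   Context: Coordinates are $(t,z,\theta,\phi)$, with $t>0$ in an open interval on which $\frac{2\xi(t)}{t}-1>0$ (so $g$ has signature $(-+++)$), and $\theta\in(0,\pi)$. $\dot{\xi}=\frac{d\xi}{dt}$, $\ddot{\xi}=\frac{d^2\xi}{dt^2}$. Let $n=\dim M=4$ and let $\nabla$ be the Levi-Civita connection of $g$. For a $(0,2)$-tensor $A$ define the endomorphism $(X\wedge_A Y)U = A(Y,U)X-A(X,U)Y$. Sign convention: the curvature endomorphism is $\mathcal{R}(X,Y)U = \nabla_{[X,Y]}U-[\nabla_X,\nabla_Y]U$. The Ricci tensor is $S(X,Y)=\mathrm{tr}\{U\mapsto \mathcal{R}(U,X)Y\}$, the Ricci operator $\mathcal{L}$ is given by $g(\mathcal{L}X,Y)=S(X,Y)$, and the scalar curvature is $r=\mathrm{tr}\,\mathcal{L}$. Further endomorphisms: $\mathcal{C}(X,Y) = \mathcal{R}(X,Y)-\frac{1}{n-2}\left(X\wedge_g \mathcal{L} Y + \mathcal{L} X\wedge_g Y - \frac{r}{n-1}X\wedge_g Y\right)$, $\mathcal{P}(X,Y) = \mathcal{R}(X,Y)-\frac{1}{n-1}X\wedge_S Y$, $\mathcal{W}(X,Y) = \mathcal{R}(X,Y)-\frac{r}{n(n-1)}X\wedge_g Y$, $\mathcal{K}(X,Y) = \mathcal{R}(X,Y)-\frac{1}{n-2}\left(X\wedge_g \mathcal{L} Y + \mathcal{L} X\wedge_g Y\right)$. For $\mathcal{D}\in\{\mathcal{R},\mathcal{C},\mathcal{P},\mathcal{W},\mathcal{K}\}$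 the corresponding $(0,4)$-tensor $D\in\{R,C,P,W,K\}$ is $D(X_1,X_2,X_3,X_4)=g(\mathcal{D}(X_1,X_2)X_3,X_4)$. For a $(0,k)$-tensor $T$, $k\ge1$, define the $(0,k+2)$-tensors $(D\cdot T)(X_1,\ldots,X_k;X,Y) = -T(\mathcal{D}(X,Y)X_1,X_2,\ldots,X_k)-\cdots-T(X_1,\ldots,X_{k-1},\mathcal{D}(X,Y)X_k)$, and, for a symmetric $(0,2)$-tensor $A$, $Q(A,T)(X_1,\ldots,X_k;X,Y) = -T((X\wedge_A Y)X_1,X_2,\ldots,X_k)-\cdots-T(X_1,\ldots,X_{k-1},(X\wedge_A Y)X_k)$. *)

(* Defs.v *)
From HB Require Import structures.
From mathcomp Require Import all_boot all_order all_algebra.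
From mathcomp Require Import all_classical all_reals all_analysis.
From mathcomp Require Import ring.

Set Implicit Arguments.
Unset Strict Implicit.
Unset Printing Implicit Defensive.

Import Order.TTheory GRing.Theory Num.Theory.
Import numFieldNormedType.Exports.

Local Open Scope classical_set_scope.
Local Open Scope ring_scope.

(* The manifold is covered by one coordinate chart, so points, and tangent
   vectors written in the coordinate frame, are both rows of 'rV[R]_4. *)
Notation dim := 4%N (only parsing).

Section CoordinateGeometry.
Variable R : realType.
Local Notation V := 'rV[R]_dim.

Definition frame (i : 'I_dim) : V := delta_mx 0 i.

Definition partial (i : 'I_dim) (f : V -> R) (p : V) : R := 'D_(frame i) f p.

(* A (pseudo-)metric is given by its matrix of components at each point. *)
Variable g : V -> 'M[R]_dim.

Definition metric (p x y : V) : R := (x *m g p *m y^T) 0 0.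

Definition christoffel (p : V) (k i j : 'I_dim) : R :=
  2^-1 * \sum_l invmx (g p) k l *
    (partial i (fun q => g q j l) p + partial j (fun q => g q i l) p
     - partial l (fun q => g q i j) p).

(* Levi-Civita connection; vector fields are functions X, Y : V -> V; see
   [nabla_torsion_free] and [nabla_metric]. *)
Definition nabla (X Y : V -> V) (p : V) : V :=
  'D_(X p) Y p +
  \row_k \sum_i \sum_j christoffel p k i j * X p 0 i * Y p 0 j.

Definition lie_bracket (X Y : V -> V) (p : V) : V :=
  'D_(X p) Y p - 'D_(Y p) X p.

Definition curvature_field (X Y U : V -> V) (p : V) : V :=
  nabla (lie_bracket X Y) U p
  - (nabla X (nabla Y U) p - nabla Y (nabla X U) p).

(* The curvature is tensorial: its value on tangent vectors at p does not depend
   on the vector fields extending them. We extend by constant components. *)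
Definition Rcurv (p x y u : V) : V :=
  curvature_field (fun=> x) (fun=> y) (fun=> u) p.

Definition trace_op (f : V -> V) : R := \tr (lin1_mx f).

Definition ricci (p x y : V) : R := trace_op (fun u => Rcurv p u x y).

(* The vector L x with metric p (L x) y = ricci p x y; see [ricci_opP]. *)
Definition ricci_op (p x : V) : V :=
  (\row_j ricci p x (frame j)) *m invmx (g p).

Definition scalar_curv (p : V) : R := trace_op (ricci_op p).

Definition wedge (A : V -> V -> R) (x y u : V) : V := A y u *: x - A x u *: y.

Definition Ccurv (p x y u : V) : V :=
  Rcurv p x y u - (dim%:R - 2)^-1 *:
    (wedge (metric p) x (ricci_op p y) u + wedge (metric p) (ricci_op p x) y u
     - (scalar_curv p / (dim%:R - 1)) *: wedge (metric p) x y u).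

Definition Pcurv (p x y u : V) : V :=
  Rcurv p x y u - (dim%:R - 1)^-1 *: wedge (ricci p) x y u.

Definition Wcurv (p x y u : V) : V :=
  Rcurv p x y u
  - (scalar_curv p / (dim%:R * (dim%:R - 1))) *: wedge (metric p) x y u.

Definition Kcurv (p x y u : V) : V :=
  Rcurv p x y u - (dim%:R - 2)^-1 *:
    (wedge (metric p) x (ricci_op p y) u + wedge (metric p) (ricci_op p x) y u).

(* (0,k)-tensors at a point. *)
Definition tensor (k : nat) := ('I_k -> V) -> R.

Definition tensor2 (A : V -> V -> R) : tensor 2 :=
  fun X => A (X (@Ordinal 2 0 isT)) (X (@Ordinal 2 1 isT)).

Definition tensor4 (p : V) (D : V -> V -> V -> V) : tensor 4 :=
  fun X => metric p
    (D (X (@Ordinal 4 0 isT)) (X (@Ordinal 4 1 isT)) (X (@Ordinal 4 2 isT)))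
    (X (@Ordinal 4 3 isT)).

(* (D . T)(X_0, ..., X_(k-1); x, y); the override [eta X with i |-> _] replaces
   the i-th argument of T. *)
Definition dot (D : V -> V -> V -> V) k (T : tensor k)
    (X : 'I_k -> V) (x y : V) : R :=
  - \sum_(i < k) T [eta X with i |-> D x y (X i)].

Definition Qten (A : V -> V -> R) k (T : tensor k)
    (X : 'I_k -> V) (x y : V) : R := dot (wedge A) T X x y.

Inductive curv_name := nR | nS | nC | nW | nK | nP.

Definition curv_arity (Z : curv_name) : nat := if Z is nS then 2 else 4.

Definition curv_tensor (p : V) (Z : curv_name) : tensor (curv_arity Z) :=
  match Z with
  | nR => tensor4 p (Rcurv p)
  | nS => tensor2 (ricci p)
  | nC => tensor4 p (Ccurv p)
  | nW => tensor4 p (Wcurv p)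
  | nK => tensor4 p (Kcurv p)
  | nP => tensor4 p (Pcurv p)
  end.

Section LeviCivita.
Hypothesis g_sym : forall q, (g q)^T = g q.

Let gC q a b : g q a b = g q b a.
Proof. by rewrite -[in LHS]g_sym mxE. Qed.

Let pgC i p a b : partial i (fun q => g q a b) p = partial i (fun q => g q b a) p.
Proof. by congr (partial i _ p); apply/funext => q; exact: gC. Qed.

Let pg p i a b := partial i (fun q => g q a b) p.

Let christoffelE p k i j : christoffel p k i j =
  2^-1 * \sum_l invmx (g p) k l * (pg p i j l + pg p j i l - pg p l i j).
Proof. by []. Qed.

Let pgsym p i a b : pg p i a b = pg p i b a. Proof. exact: pgC. Qed.

Lemma christoffel_sym p k i j : christoffel p k i j = christoffel p k j i.
Proof.
rewrite !christoffelE; congr (_ * _); apply: eq_bigr => l _; congr (_ * _).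
by rewrite [pg p i j l + _]addrC (pgsym p l).
Qed.

Lemma nabla_torsion_free X Y p : nabla X Y p - nabla Y X p = lie_bracket X Y p.
Proof.
rewrite /nabla /lie_bracket opprD addrACA -[RHS]addr0; congr (_ + _).
apply/eqP; rewrite subr_eq0; apply/eqP/rowP => k; rewrite !mxE exchange_big /=.
apply: eq_bigr => i _; apply: eq_bigr => j _.
by rewrite christoffel_sym mulrAC.
Qed.

Variable p : V.
Hypothesis g_unit : g p \in unitmx.

Lemma ricci_opP x j : metric p (ricci_op p x) (frame j) = ricci p x (frame j).
Proof.
rewrite /metric /ricci_op mulmxKV // trmx_delta mxE (bigD1 j) //= big1.
  by rewrite !mxE !eqxx mulr1 addr0.
by move=> i ij; rewrite [delta_mx _ _ _ _]mxE (negbTE ij) mulr0.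
Qed.

Let christoffel_lower i j m : \sum_k christoffel p k i j * g p k m =
  2^-1 * (pg p i j m + pg p j i m - pg p m i j).
Proof.
under eq_bigr do rewrite christoffelE -mulrA mulr_suml.
rewrite -mulr_sumr; congr (_ * _); rewrite exchange_big /=.
have E l : \sum_k g p m k * invmx (g p) k l = (m == l)%:R.
  by have := mulmxV g_unit => /matrixP/(_ m l); rewrite !mxE.
transitivity (\sum_l (m == l)%:R * (pg p i j l + pg p j i l - pg p l i j)).
  apply: eq_bigr => l _; rewrite -E mulr_suml; apply: eq_bigr => k _.
  by rewrite mulrAC gC [invmx _ _ _ * _]mulrC.
rewrite (bigD1 m) //= eqxx mul1r big1 ?addr0 // => l lm.
by rewrite eq_sym (negbTE lm) mul0r.
Qed.

Let christoffel_metric l i j : pg p l i j =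
  \sum_k christoffel p k l i * g p k j + \sum_k christoffel p k l j * g p k i.
Proof.
rewrite !christoffel_lower (pgsym p l j i) (pgsym p i l j) (pgsym p j l i).
rewrite -mulrDr.
move: (pg p l i j) (pg p i j l) (pg p j i l) => a b c.
by field.
Qed.


Let nabla_comp (X Y : V -> V) a : derivable Y p (X p) ->
  nabla X Y p 0 a = 'D_(X p) (fun q => Y q 0 a) p +
    \sum_l \sum_c christoffel p a l c * X p 0 l * Y p 0 c.
Proof. by move=> dY; rewrite /nabla !mxE derive_mx // mxE. Qed.

Let metricE q x y : metric q x y = \sum_b \sum_a x 0 a * g q a b * y 0 b.
Proof.
by rewrite /metric mxE; apply: eq_bigr => b _; rewrite !mxE mulr_suml.
Qed.

Let gamma_sum (x y z : V) :
  \sum_b \sum_a (\sum_l \sum_c christoffel p a l c * x 0 l * y 0 c) * g p a b *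
     z 0 b =
  \sum_b \sum_c \sum_l y 0 c * (x 0 l * \sum_a christoffel p a l c * g p a b) *
     z 0 b.
Proof.
apply: eq_bigr => b _.
under eq_bigr do rewrite 2!mulr_suml.
rewrite exchange_big /= [RHS]exchange_big /=; apply: eq_bigr => l _.
under eq_bigr do rewrite 2!mulr_suml.
rewrite exchange_big /=; apply: eq_bigr => c _.
rewrite mulr_sumr mulr_sumr mulr_suml; apply: eq_bigr => a _.
by ring.
Qed.

(* X <Y, Z> = <nabla_X Y, Z> + <Y, nabla_X Z> *)
Lemma nabla_metric (X Y Z : V -> V) :
  differentiable g p -> differentiable Y p -> differentiable Z p ->
  'D_(X p) (fun q => metric q (Y q) (Z q)) p =
  metric p (nabla X Y p) (Z p) + metric p (Y p) (nabla X Z p).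
Proof.
move=> dg dY dZ.
have dfg v : derivable g p v by exact: diff_derivable.
have dfY v : derivable Y p v by exact: diff_derivable.
have dfZ v : derivable Z p v by exact: diff_derivable.
have dgX a b : derivable (fun q => g q a b) p (X p).
  by move: (dfg (X p)) => /derivable_mxP.
have dYX a : derivable (fun q => Y q 0 a) p (X p).
  by move: (dfY (X p)) => /derivable_mxP.
have dZX a : derivable (fun q => Z q 0 a) p (X p).
  by move: (dfZ (X p)) => /derivable_mxP.
have Dg a b : 'D_(X p) (fun q => g q a b) p = \sum_l X p 0 l * pg p l a b.
  transitivity (('D_(X p) g p) a b); first by rewrite derive_mx // mxE.
  rewrite deriveE // [in LHS](row_sum_delta (X p)) linear_sum summxE.
  apply: eq_bigr => l _; rewrite linearZ mxE; congr (_ * _).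
  by rewrite -deriveE // derive_mx // mxE.
have DY a b : derivable (fun q => Y q 0 a * g q a b) p (X p).
  exact: derivableM.
have DYZ a b : derivable (fun q => Y q 0 a * g q a b * Z q 0 b) p (X p).
  exact: derivableM (DY a b) (dZX b).
have sumP (f : 'I_4 -> V -> R) v : (forall i, derivable (f i) p v) ->
    derivable (fun q => \sum_i f i q) p v /\
    'D_v (fun q => \sum_i f i q) p = \sum_i 'D_v (f i) p.
  move=> df; have -> : (fun q => \sum_i f i q) = \sum_i f i.
    by apply/funext => q; rewrite fct_sumE.
  by split; [exact: derivable_sum|exact: derive_sum].
have DS b := sumP _ _ (DYZ^~ b).
have -> : 'D_(X p) (fun q => metric q (Y q) (Z q)) p =
    \sum_b \sum_a ('D_(X p) (fun q => Y q 0 a) p * g p a b * Z p 0 b +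
      Y p 0 a * (\sum_l X p 0 l * pg p l a b) * Z p 0 b +
      Y p 0 a * g p a b * 'D_(X p) (fun q => Z q 0 b) p).
  under eq_fun do rewrite metricE.
  rewrite (sumP _ _ (fun b => (DS b).1)).2; apply: eq_bigr => b _.
  rewrite (DS b).2; apply: eq_bigr => a _.
  rewrite (deriveM (DY a b) (dZX b)) (deriveM (dYX a) (dgX a b)) Dg.
  rewrite /GRing.scale /=; move: (\sum_l _) => s; by ring.
rewrite !metricE.
under [X in _ = X + _]eq_bigr => b _ do
  under eq_bigr => a _ do rewrite nabla_comp // 2!mulrDl.
under [X in _ = _ + X]eq_bigr => b _ do
  under eq_bigr => a _ do rewrite nabla_comp // mulrDr.
under [LHS]eq_bigr => b _ do rewrite 2!big_split /=.
under [X in _ = X + _]eq_bigr => b _ do rewrite big_split /=.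
under [X in _ = _ + X]eq_bigr => b _ do rewrite big_split /=.
rewrite !big_split /= gamma_sum.
set A := \sum_(i < 4) _; set B := \sum_(i < 4) _; set C := \sum_(i < 4) _.
set E := \sum_(i < 4) _; set F := \sum_(i < 4) _.
suff -> : B = E + F by ring.
have -> : F = \sum_b \sum_a (\sum_l \sum_c christoffel p a l c * X p 0 l * Z p 0 c) * g p a b *
     Y p 0 b.
  rewrite /F exchange_big; apply: eq_bigr => a _; apply: eq_bigr => b _ /=.
  by rewrite gC; move: (\sum_l _) => s; ring.
rewrite gamma_sum [X in _ + X]exchange_big -big_split; apply: eq_bigr => b _.
rewrite -big_split; apply: eq_bigr => a _ /=.
rewrite mulr_sumr mulr_suml -big_split; apply: eq_bigr => l _ /=.
rewrite christoffel_metric.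
move: (\sum_k _) (\sum_k _) => s t; by ring.
Qed.

End LeviCivita.
End CoordinateGeometry.

Arguments curv_tensor {R} g p Z _ : assert.

Section BlackHole.
Variable R : realType.
Local Notation V := 'rV[R]_dim.

(* The coordinates (t, z, theta, phi) have indices 0, 1, 2, 3. *)
Definition coord_t (p : V) : R := p 0 (@Ordinal 4 0 isT).
Definition coord_theta (p : V) : R := p 0 (@Ordinal 4 2 isT).

Definition bh_metric (xi : R -> R) (p : V) : 'M[R]_dim :=
  let t := coord_t p in
  let f := 2 * xi t / t - 1 in
  diag_mx (\row_(i < dim)
    [:: - f^-1; f; t ^+ 2; t ^+ 2 * sin (coord_theta p) ^+ 2]`_i).

Definition bh_domain (I : set R) : set V :=
  [set p | I (coord_t p) /\ 0 < coord_theta p < pi].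

Definition smooth_on (I : set R) (f : R -> R) : Prop :=
  forall n t, I t -> derivable (f^`(n))%classic t 1.

End BlackHole.

(* Main.v *)
(* The metric splits into the blocks (t, z) and (theta, phi); let h, k be its
   restrictions to them, extended by 0.  The wedge operator x /\_g y decomposes
   into parts along the (t, z)-plane, the four mixed coordinate planes and the
   (theta, phi)-plane, and R(x, y) is obtained by rescaling these parts by factors
   a, m, e.  The same holds for C, W and K, with other factors.  The operator with
   factors (a, m, e) differs from m (x /\_g y) by infinitesimal rotations of the
   two blocks; those annihilate every tensor built from h and k, in particular R,
   S, C, W, K and P.  Hence L1, L2, L3 are the mixed factors of R, of C and W, and
   of K.  For P use P(x, y) = R(x, y) - (x /\_S y) / 3 and Q(S, S) = 0. *)
Require Import Defs.
From mathcomp Require Import all_boot all_order all_algebra.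
From mathcomp Require Import all_classical all_reals all_analysis.
From mathcomp Require Import ring.

Set Implicit Arguments.
Unset Strict Implicit.
Unset Printing Implicit Defensive.

Import Order.TTheory GRing.Theory Num.Theory.
Import numFieldNormedType.Exports.

Local Open Scope classical_set_scope.
Local Open Scope ring_scope.

Local Notation i0 := (@Ordinal 4 0 isT).
Local Notation i1 := (@Ordinal 4 1 isT).
Local Notation i2 := (@Ordinal 4 2 isT).
Local Notation i3 := (@Ordinal 4 3 isT).

(** * Four-element index sets and inverses of diagonal matrices *)

Lemma ord4P (P : 'I_4 -> Prop) : P i0 -> P i1 -> P i2 -> P i3 -> forall i, P i.
Proof.
by move=> P0 P1 P2 P3 [[|[|[|[|//]]]] lti]; rewrite (bool_irrelevance lti isT).
Qed.

Lemma sum_ord4 (V : nmodType) (F : 'I_4 -> V) :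
  \sum_i F i = F i0 + F i1 + F i2 + F i3.
Proof.
rewrite !big_ord_recl big_ord0 addr0 !addrA.
by congr (F _ + F _ + F _ + F _); apply: val_inj.
Qed.

Lemma invmx_diag (F : fieldType) n (d : 'rV[F]_n) : (forall i, d 0 i != 0) ->
  invmx (diag_mx d) = diag_mx (map_mx GRing.inv d).
Proof.
move=> d_neq0; have dK : diag_mx d *m diag_mx (map_mx GRing.inv d) = 1%:M.
  rewrite mulmx_diag -diag_const_mx; congr diag_mx.
  by apply/rowP => i; rewrite !mxE divff.
have [d_unit _] := mulmx1_unit dK.
by rewrite -[RHS]mul1mx -(mulVmx d_unit) -mulmxA dK mulmx1.
Qed.

(** * Algebra of operators that respect the splitting (t, z) + (theta, phi) *)

Section BlockOperators.
Variables (R : realType) (d : 'rV[R]_4).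
Local Notation V := 'rV[R]_4.
Implicit Types (x y u v : V) (a b c e m s : R).

(** With [d] the diagonal of the metric, [form1] and [form2] are the restrictions h and k. *)
Definition form1 x y : R :=
  d 0 i0 * x 0 i0 * y 0 i0 + d 0 i1 * x 0 i1 * y 0 i1.

Definition form2 x y : R :=
  d 0 i2 * x 0 i2 * y 0 i2 + d 0 i3 * x 0 i3 * y 0 i3.

Definition block_form s1 s2 x y : R := s1 * form1 x y + s2 * form2 x y.

(* The factor of the mixed planes is b = c, except for P, where b <> c. *)
Definition block_op a b c e x y u : V := \row_i
  (if (i < 2)%N then block_form a b y u * x 0 i - block_form a b x u * y 0 i
   else block_form c e y u * x 0 i - block_form c e x u * y 0 i).

Lemma form1C x y : form1 x y = form1 y x.
Proof. by rewrite /form1; ring. Qed.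

Lemma form2C x y : form2 x y = form2 y x.
Proof. by rewrite /form2; ring. Qed.

(** Pairing with a vector removes all coordinates: later identities become polynomial in values of
    [form1] and [form2]. *)
Lemma form1_block_op a b c e x y u v : form1 (block_op a b c e x y u) v =
  block_form a b y u * form1 x v - block_form a b x u * form1 y v.
Proof. by rewrite {1}/form1 !mxE /= /form1; ring. Qed.

Lemma form2_block_op a b c e x y u v : form2 (block_op a b c e x y u) v =
  block_form c e y u * form2 x v - block_form c e x u * form2 y v.
Proof. by rewrite {1}/form2 !mxE /= /form2; ring. Qed.

(** The coefficient A(y, u) depends on the block of the argument u, not on that of the output, so
    the two mixed factors differ as soon as [s1] and [s2] do. *)
Lemma wedge_block_form s1 s2 :
  wedge (block_form s1 s2) = block_op s1 s2 s1 s2.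
Proof.
apply/funext => x; apply/funext => y; apply/funext => u.
by apply/rowP; apply: ord4P; rewrite !mxE.
Qed.

Lemma block_opB a b c e a' b' c' e' k x y u :
  block_op a b c e x y u - k *: block_op a' b' c' e' x y u =
  block_op (a - k * a') (b - k * b') (c - k * c') (e - k * e') x y u.
Proof.
apply/rowP; apply: ord4P; rewrite !mxE /= /block_form.
all: by move: (form1 _ _) (form1 _ _) (form2 _ _) (form2 _ _); intros; ring.
Qed.

Section Metric.
Variables (g : V -> 'M[R]_4) (p : V).
Hypothesis gE : g p = diag_mx d.

Lemma metric_block : metric g p = block_form 1 1.
Proof.
apply/funext => x; apply/funext => y.
rewrite /metric gE mxE sum_ord4 !mul_mx_diag !mxE /block_form /form1 /form2.
by ring.
Qed.

Lemma dot_tensor2 D (A : V -> V -> R) X x y : dot D (tensor2 A) X x y =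
  - (A (D x y (X (@Ordinal 2 0 isT))) (X (@Ordinal 2 1 isT)) +
     A (X (@Ordinal 2 0 isT)) (D x y (X (@Ordinal 2 1 isT)))).
Proof.
rewrite /dot big_ord_recl big_ord1 /tensor2 /=.
by congr (- (A (D _ _ (X _)) _ + A _ (D _ _ (X _)))); apply: val_inj.
Qed.

Lemma dot_tensor4 D E X x y : dot D (tensor4 g p E) X x y =
  - (metric g p (E (D x y (X i0)) (X i1) (X i2)) (X i3) +
     metric g p (E (X i0) (D x y (X i1)) (X i2)) (X i3) +
     metric g p (E (X i0) (X i1) (D x y (X i2))) (X i3) +
     metric g p (E (X i0) (X i1) (X i2)) (D x y (X i3))).
Proof. by rewrite /dot sum_ord4. Qed.

(** In h(Du, v) + h(u, Dv) the terms in [a] cancel by antisymmetry, and likewise those in [e] for k.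
    What is left is linear in [m], and a = m = e = 1 gives Q(g, .). *)
Lemma dot_block_op_form a m e s1 s2 X x y :
  dot (block_op a m m e) (tensor2 (block_form s1 s2)) X x y =
  m * Qten (metric g p) (tensor2 (block_form s1 s2)) X x y.
Proof.
rewrite /Qten metric_block wedge_block_form !dot_tensor2.
move: (X _) (X _) => u v; rewrite {X} /block_form.
(* Symmetry moves every operator into the first slot, where [form1_block_op] and [form2_block_op]
   apply. *)
rewrite !(form1C _ (block_op _ _ _ _ _ _ _)) !(form2C _ (block_op _ _ _ _ _ _ _)).
rewrite !form1_block_op !form2_block_op /block_form.
move: (form1 x u) (form1 y u) (form1 x v) (form1 y v).
move: (form2 x u) (form2 y u) (form2 x v) (form2 y v).
by intros; ring.
Qed.

(** The cancellation is that of [dot_block_op_form]. The inner factors are arbitrary, which covers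
    the tensor P with its unequal mixed factors. *)
Lemma dot_block_op a m e a' b' c' e' X x y :
  dot (block_op a m m e) (tensor4 g p (block_op a' b' c' e')) X x y =
  m * Qten (metric g p) (tensor4 g p (block_op a' b' c' e')) X x y.
Proof.
rewrite /Qten [in wedge _]metric_block wedge_block_form !dot_tensor4 metric_block.
move: (X i0) (X i1) (X i2) (X i3) => v0 v1 v2 v3; rewrite {X} /block_form.
(* The inner operator is expanded first; fixing its factors keeps the acting operator intact inside
   its arguments. *)
rewrite !(form1_block_op a' b' c' e') !(form2_block_op a' b' c' e') /block_form.
rewrite !(form1C _ (block_op _ _ _ _ x y _)) !(form2C _ (block_op _ _ _ _ x y _)).
rewrite !form1_block_op !form2_block_op /block_form.
(* The 24 remaining values of the two forms become independent variables. *)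
move: (form1 x _) (form1 x _) (form1 x _) (form1 x _).
move: (form1 y _) (form1 y _) (form1 y _) (form1 y _).
move: (form2 x _) (form2 x _) (form2 x _) (form2 x _).
move: (form2 y _) (form2 y _) (form2 y _) (form2 y _).
move: (form1 _ _) (form1 _ _) (form1 _ _) (form1 _ _).
move: (form2 _ _) (form2 _ _) (form2 _ _) (form2 _ _).
by intros; ring.
Qed.

(** [dot] is linear in the acting operator. The mixed factors stay separate so that P and the wedge
    of S are included. *)
Lemma dot_block_opB_form a b c e a' b' c' e' k s1 s2 X x y :
  let T := tensor2 (block_form s1 s2) in
  dot (block_op (a - k * a') (b - k * b') (c - k * c') (e - k * e')) T X x y =
  dot (block_op a b c e) T X x y - k * dot (block_op a' b' c' e') T X x y.
Proof.
rewrite /= !dot_tensor2 /block_form.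
rewrite !(form1C _ (block_op _ _ _ _ _ _ _)) !(form2C _ (block_op _ _ _ _ _ _ _)).
rewrite !form1_block_op !form2_block_op /block_form.
by ring.
Qed.

Lemma dot_block_opB a b c e a' b' c' e' a2 b2 c2 e2 k X x y :
  let T := tensor4 g p (block_op a2 b2 c2 e2) in
  dot (block_op (a - k * a') (b - k * b') (c - k * c') (e - k * e')) T X x y =
  dot (block_op a b c e) T X x y - k * dot (block_op a' b' c' e') T X x y.
Proof.
rewrite /= !dot_tensor4 metric_block.
rewrite /block_form !(form1_block_op a2) !(form2_block_op a2) /block_form.
rewrite !(form1C _ (block_op _ _ _ _ x y _)) !(form2C _ (block_op _ _ _ _ x y _)).
rewrite !form1_block_op !form2_block_op /block_form.
by ring.
Qed.

(** * Ricci tensor and the derived curvature operators in block form *)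

Section Ricci.
Variables a m e : R.
Hypothesis d_neq0 : forall i, d 0 i != 0.
Hypothesis RE : Rcurv g p = block_op a m m e.

(** [s1] and [s2] are the Ricci eigenvalues on the two blocks: each coordinate direction lies in one
    plane inside its block and in two mixed planes. *)
Let s1 := a + 2 * m.
Let s2 := 2 * m + e.

Lemma ricci_block : ricci g p = block_form s1 s2.
Proof.
apply/funext => x; apply/funext => y; rewrite /ricci RE /trace_op /mxtrace.
rewrite sum_ord4 !mxE /= /block_form /form1 /form2 !mxE /=.
by rewrite /s1 /s2; ring.
Qed.

Lemma ricci_op_block x :
  ricci_op g p x = \row_i ((if (i < 2)%N then s1 else s2) * x 0 i).
Proof.
rewrite /ricci_op ricci_block gE invmx_diag //.
apply/rowP; apply: ord4P; rewrite mul_mx_diag !mxE /= /block_form /form1 /form2 !mxE /=.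
all: by field; rewrite d_neq0.
Qed.

Lemma scalar_block : scalar_curv g p = 2 * (s1 + s2).
Proof.
rewrite /scalar_curv (funext ricci_op_block) /trace_op /mxtrace sum_ord4.
by rewrite !mxE /= /s1 /s2; ring.
Qed.

(** Each coordinate plane is scaled by the sum of the Ricci eigenvalues of its two directions. *)
Lemma wedge_ricci_op x y u :
  wedge (metric g p) x (ricci_op g p y) u + wedge (metric g p) (ricci_op g p x) y u
  = block_op (2 * s1) (s1 + s2) (s1 + s2) (2 * s2) x y u.
Proof.
apply/rowP; apply: ord4P; rewrite metric_block !ricci_op_block !mxE /=.
all: rewrite /block_form /form1 /form2 !mxE /=; ring.
Qed.

Lemma Kcurv_block :
  Kcurv g p = block_op (a - s1) (m - (s1 + s2) / 2) (m - (s1 + s2) / 2) (e - s2).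
Proof.
apply/funext => x; apply/funext => y; apply/funext => u.
rewrite /Kcurv RE wedge_ricci_op block_opB.
by congr (block_op _ _ _ _ _ _ _); field.
Qed.

(** Here k = r / ((n-1)(n-2)) with r = 2 (s1 + s2). The mixed factor is m - 3k/2 + k. *)
Lemma Ccurv_block : let k := (s1 + s2) / 3 in
  Ccurv g p = block_op (a - s1 + k) (m - k / 2) (m - k / 2) (e - s2 + k).
Proof.
move=> k; apply/funext => x; apply/funext => y; apply/funext => u.
rewrite /Ccurv RE wedge_ricci_op metric_block wedge_block_form !block_opB.
rewrite scalar_block /k.
by congr (block_op _ _ _ _ _ _ _); field.
Qed.

(** Here k = r / (n(n-1)). The mixed factor m - (s1 + s2)/6 is also that of C, which is why both
    conditions hold with the same L2. *)
Lemma Wcurv_block : let k := (s1 + s2) / 6 in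
  Wcurv g p = block_op (a - k) (m - k) (m - k) (e - k).
Proof.
move=> k; apply/funext => x; apply/funext => y; apply/funext => u.
rewrite /Wcurv RE metric_block wedge_block_form !block_opB scalar_block /k.
by congr (block_op _ _ _ _ _ _ _); field.
Qed.

Lemma Pcurv_block : Pcurv g p =
  block_op (a - 3^-1 * s1) (m - 3^-1 * s2) (m - 3^-1 * s1) (e - 3^-1 * s2).
Proof.
apply/funext => x; apply/funext => y; apply/funext => u.
rewrite /Pcurv RE ricci_block wedge_block_form block_opB.
by congr (block_op _ _ _ _ _ _ _); field.
Qed.

Lemma dot_curv_tensor a' m' e' Z X x y :
  dot (block_op a' m' m' e') (curv_tensor g p Z) X x y =
  m' * Qten (metric g p) (curv_tensor g p Z) X x y.
Proof.
case: Z X => X /=.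
- by rewrite RE dot_block_op.
- by rewrite ricci_block dot_block_op_form.
- by rewrite Ccurv_block dot_block_op.
- by rewrite Wcurv_block dot_block_op.
- by rewrite Kcurv_block dot_block_op.
- by rewrite Pcurv_block dot_block_op.
Qed.

Lemma dot_Pcurv Z X x y : dot (Pcurv g p) (curv_tensor g p Z) X x y =
  dot (Rcurv g p) (curv_tensor g p Z) X x y
  - 3^-1 * Qten (ricci g p) (curv_tensor g p Z) X x y.
Proof.
rewrite /Qten ricci_block wedge_block_form Pcurv_block RE.
case: Z X => X /=.
- by rewrite RE dot_block_opB.
- by rewrite ricci_block dot_block_opB_form.
- by rewrite Ccurv_block dot_block_opB.
- by rewrite Wcurv_block dot_block_opB.
- by rewrite Kcurv_block dot_block_opB.
- by rewrite Pcurv_block dot_block_opB.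
Qed.

(** S((x /\_S y) u, v) = S(y, u) S(x, v) - S(x, u) S(y, v) is antisymmetric in u and v. *)
Lemma Qten_ricci X x y : Qten (ricci g p) (tensor2 (ricci g p)) X x y = 0.
Proof.
rewrite /Qten dot_tensor2 ricci_block wedge_block_form /block_form.
rewrite !(form1C _ (block_op _ _ _ _ _ _ _)) !(form2C _ (block_op _ _ _ _ _ _ _)).
rewrite !form1_block_op !form2_block_op /block_form.
by ring.
Qed.

End Ricci.
End Metric.
End BlockOperators.

(** * Differentiation rules for functions of the coordinates *)

Section PointwiseDerivatives.
Variables (R : realType) (V : normedModType R) (p v : V).
Implicit Types (F G : V -> R) (dF dG c : R).

Lemma is_derive_add F G dF dG : is_derive p v F dF -> is_derive p v G dG ->
  is_derive p v (fun q => F q + G q) (dF + dG).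
Proof. exact: is_deriveD. Qed.

Lemma is_derive_sub F G dF dG : is_derive p v F dF -> is_derive p v G dG ->
  is_derive p v (fun q => F q - G q) (dF - dG).
Proof. exact: is_deriveB. Qed.

Lemma is_derive_mul F G dF dG : is_derive p v F dF -> is_derive p v G dG ->
  is_derive p v (fun q => F q * G q) (F p * dG + G p * dF).
Proof. exact: is_deriveM. Qed.

Lemma is_derive_mulr F dF c : is_derive p v F dF ->
  is_derive p v (fun q => F q * c) (dF * c).
Proof.
move=> dFp; have := is_derive_mul dFp (is_derive_cst c p v).
by move/is_derive_eq; apply; rewrite mulr0 add0r mulrC.
Qed.

End PointwiseDerivatives.

Lemma is_derive_row (R : realType) (V : normedModType R) n
    (M : V -> 'rV[R]_n) (D : 'rV[R]_n) (p v : V) :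
  (forall j, is_derive p v (fun q => M q 0 j) (D 0 j)) -> is_derive p v M D.
Proof.
move=> dM; have dMp : derivable M p v.
  by apply/derivable_mxP => i j; rewrite ord1; case: (dM j).
apply: DeriveDef => //; rewrite derive_mx //.
by apply/rowP => j; rewrite mxE; case: (dM j).
Qed.

Lemma is_derive_comp_coord (R : realType) n (F : R -> R) (dF : R)
    (p v : 'rV[R]_n) j :
  is_derive (p 0 j) 1 F dF -> is_derive p v (fun q => F (q 0 j)) (v 0 j * dF).
Proof.
move=> [Fp <-]; have dF1 := (derivable1_diffP _ _).1 Fp.
have dc := differentiable_coord p 0 j.
have dFc : differentiable (F \o (fun q : 'rV[R]_n => q 0 j)) p.
  exact: differentiable_comp.
apply: DeriveDef; first exact: diff_derivable.
rewrite [LHS](deriveE v dFc) diff_comp //=.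
(* The coordinate projection is linear, hence its own differential. *)
have -> : 'd (fun q : 'rV[R]_n => q 0 j : R) p v = v 0 j.
  rewrite -deriveE //.
  have := derive_mx (@derivable_id _ _ p v).
  by rewrite derive_id => /rowP/(_ j); rewrite mxE => <-.
by rewrite -[X in 'd F _ X]mulr1 [LHS]linearZ -deriveE.
Qed.

(** * Christoffel symbols of a diagonal metric *)

Section DiagonalMetric.
Variables (R : realType) (d : 'rV[R]_4 -> 'rV[R]_4).

Lemma partial_diag i j l p : partial i (fun q => diag_mx (d q) j l) p =
  partial i (fun q => d q 0 j) p *+ (j == l).
Proof.
under eq_fun do rewrite mxE.
by have [->|_] := eqVneq j l; rewrite ?mulr1n // mulr0n /partial derive_cst.
Qed.

Lemma christoffel_diag p k i j : (forall i, d p 0 i != 0) ->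
  christoffel (fun q => diag_mx (d q)) p k i j =
  2^-1 * (d p 0 k)^-1 *
    (partial i (fun q => d q 0 j) p *+ (j == k)
     + partial j (fun q => d q 0 i) p *+ (i == k)
     - partial k (fun q => d q 0 i) p *+ (i == j)).
Proof.
move=> d_neq0; rewrite /christoffel invmx_diag // -mulrA; congr (_ * _).
rewrite (bigD1 k) //= big1 ?addr0 => [|l /negbTE lk].
  by rewrite !mxE eqxx mulr1n !partial_diag.
by rewrite !mxE eq_sym lk mul0r.
Qed.

End DiagonalMetric.

(** * Connection of the metric with a general profile [f] in place of 2 xi / t - 1 *)

Section WarpedMetric.
Variables (R : realType) (f f1 : R -> R).
Local Notation V := 'rV[R]_4.
Implicit Types p q x y u v : V.

Definition warped_diag p : V := let t := coord_t p in
  \row_(i < 4) [:: - (f t)^-1; f t; t ^+ 2; t ^+ 2 * sin (coord_theta p) ^+ 2]`_i.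

Definition warped_metric p : 'M[R]_4 := diag_mx (warped_diag p).

(* The derivative along coordinate i of the l-th diagonal entry. *)
Definition warped_partial p (i l : nat) : R :=
  let t := coord_t p in let th := coord_theta p in
  match i with
  | 0%N => [:: f1 t / f t ^+ 2; f1 t; 2 * t; 2 * t * sin th ^+ 2]`_l
  | 2%N => [:: 0; 0; 0; t ^+ 2 * (2 * sin th * cos th)]`_l
  | _ => 0
  end.

(** The Christoffel term of the connection in closed form. Functions of the base point stand to the
    left of the components of [x] and [y], ready for differentiation by [is_derive_mulr]. *)
Definition warped_gamma p x y : V :=
  let t := coord_t p in let s := sin (coord_theta p) in
  let c := cos (coord_theta p) in
  \row_(i < 4)
  [:: - (f1 t / f t) * (2^-1 * x 0 i0 * y 0 i0)
      + f t * f1 t * (2^-1 * x 0 i1 * y 0 i1)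
      + t * f t * (x 0 i2 * y 0 i2) + t * f t * s ^+ 2 * (x 0 i3 * y 0 i3);
      f1 t / f t * (2^-1 * (x 0 i0 * y 0 i1 + x 0 i1 * y 0 i0));
      t^-1 * (x 0 i0 * y 0 i2 + x 0 i2 * y 0 i0) - s * c * (x 0 i3 * y 0 i3);
      t^-1 * (x 0 i0 * y 0 i3 + x 0 i3 * y 0 i0)
      + c / s * (x 0 i2 * y 0 i3 + x 0 i3 * y 0 i2)]`_i.

Lemma warped_partialE q i l : f (coord_t q) != 0 ->
  is_derive (coord_t q) 1 f (f1 (coord_t q)) ->
  partial i (fun q => warped_diag q 0 l) q = warped_partial q i l.
Proof.
move=> fq_neq0 df.
have dt v F dF := @is_derive_comp_coord R 4 F dF q v i0.
have dth v F dF := @is_derive_comp_coord R 4 F dF q v i2.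
have d2 (z : R) : is_derive z 1 (fun t : R => t ^+ 2) (2 * z).
  by apply: is_derive_eq; rewrite /GRing.scale /=; ring.
(* The metric depends on t and theta only, so a directional derivative has two terms. *)
suff dl v : is_derive q v (fun q => warped_diag q 0 l)
    (v 0 i0 * warped_partial q 0 l + v 0 i2 * warped_partial q 2 l).
  rewrite /partial; have [_ ->] := dl (frame R i).
  by move: i; apply: ord4P; rewrite !mxE /= ?mul0r ?mul1r ?addr0 ?add0r.
under eq_fun do rewrite mxE.
move: l; apply: ord4P => /=.
- have dN : is_derive (coord_t q) 1 (fun t => - (f t)^-1)
      (f1 (coord_t q) / f (coord_t q) ^+ 2).
    have := is_deriveN (is_deriveV fq_neq0 df); move/is_derive_eq; apply.
    by rewrite /GRing.scale /= mulNr opprK mulrC.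
  by move: (dt v _ _ dN) => /is_derive_eq; apply; rewrite mulr0 addr0.
- by move: (dt v _ _ df) => /is_derive_eq; apply; rewrite mulr0 addr0.
- by move: (dt v _ _ (d2 _)) => /is_derive_eq; apply; rewrite mulr0 addr0.
- have ds := is_derive1_comp (d2 (sin (q 0 i2))) (is_derive_sin (q 0 i2)).
  have := is_derive_mul (dt v _ _ (d2 _)) (dth v _ _ ds).
  move/is_derive_eq; apply.
  by rewrite /= /coord_t /coord_theta; ring.
Qed.

Definition warped_regular q :=
  [/\ coord_t q != 0, f (coord_t q) != 0 & sin (coord_theta q) != 0].

Lemma warped_diag_neq0 q i : warped_regular q -> warped_diag q 0 i != 0.
Proof.
case=> t0 f0 s0; move: i; apply: ord4P; rewrite !mxE /= ?oppr_eq0 ?invr_eq0 //.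
all: by rewrite ?mulf_neq0 ?expf_neq0.
Qed.

Lemma nabla_warped (X Y : V -> V) q : warped_regular q ->
  is_derive (coord_t q) 1 f (f1 (coord_t q)) ->
  nabla warped_metric X Y q = 'D_(X q) Y q + warped_gamma q (X q) (Y q).
Proof.
move=> reg df; have [t0 f0 s0] := reg.
rewrite /nabla; congr (_ + _); apply/rowP => k.
pose G k i j : R := 2^-1 * (warped_diag q 0 k)^-1 *
    (warped_partial q i j *+ (j == k) + warped_partial q j i *+ (i == k)
     - warped_partial q k i *+ (i == j)).
have GE i j : christoffel warped_metric q k i j = G k i j.
  rewrite christoffel_diag ?warped_partialE // => l.
  exact: warped_diag_neq0.
rewrite mxE.
under eq_bigr do under eq_bigr do rewrite GE.
rewrite !sum_ord4; move: k {GE}; apply: ord4P.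
all: by rewrite /G !mxE /= !mulr0n !mulr1n; field; rewrite ?t0 ?f0 ?s0.
Qed.

(** * Curvature of the general-profile metric *)

Section Curvature.
Variables (p : V) (f2 : R).
Local Notation t := (coord_t p).
Local Notation s := (sin (coord_theta p)).
Local Notation c := (cos (coord_theta p)).
Hypothesis p_regular : warped_regular p.
Hypothesis df : is_derive t 1 f (f1 t).
Hypothesis df1 : is_derive t 1 f1 f2.

Definition warped_gamma_derive v x y : V := \row_(i < 4)
  [:: v 0 i0 * - ((f t * f2 - f1 t ^+ 2) / f t ^+ 2) * (2^-1 * x 0 i0 * y 0 i0)
      + v 0 i0 * (f1 t ^+ 2 + f t * f2) * (2^-1 * x 0 i1 * y 0 i1)
      + v 0 i0 * (f t + t * f1 t) * (x 0 i2 * y 0 i2)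
      + (v 0 i0 * (f t + t * f1 t) * s ^+ 2
         + v 0 i2 * (t * f t * (2 * s * c))) * (x 0 i3 * y 0 i3);
      v 0 i0 * ((f t * f2 - f1 t ^+ 2) / f t ^+ 2) *
      (2^-1 * (x 0 i0 * y 0 i1 + x 0 i1 * y 0 i0));
      v 0 i0 * - t ^- 2 * (x 0 i0 * y 0 i2 + x 0 i2 * y 0 i0)
      - v 0 i2 * (c ^+ 2 - s ^+ 2) * (x 0 i3 * y 0 i3);
      v 0 i0 * - t ^- 2 * (x 0 i0 * y 0 i3 + x 0 i3 * y 0 i0)
      - v 0 i2 * s ^- 2 * (x 0 i2 * y 0 i3 + x 0 i3 * y 0 i2)]`_i.

Lemma is_derive_warped_gamma v x y :
  is_derive p v (fun q => warped_gamma q x y) (warped_gamma_derive v x y).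
Proof.
have [t0 f0 s0] := p_regular.
have dt F dF := @is_derive_comp_coord R 4 F dF p v i0.
have dth F dF := @is_derive_comp_coord R 4 F dF p v i2.
have did : is_derive t 1 (fun t : R => t) 1 by exact: is_derive_id.
have dV := is_deriveV t0 did.
have dfV := is_derive_mul df1 (is_deriveV f0 df).
have dff := is_derive_mul df df1.
have dtf := is_derive_mul did df.
have dsin := is_derive_sin (coord_theta p).
have dcos := is_derive_cos (coord_theta p).
have dsc := is_derive_mul dsin dcos.
have dcs := is_derive_mul dcos (is_deriveV s0 dsin).
have dss := is_derive_mul dsin dsin.
apply: is_derive_row; apply: ord4P; rewrite /warped_gamma /warped_gamma_derive.
all: under eq_fun do rewrite mxE; rewrite mxE /=.
- have := is_derive_add (is_derive_add (is_derive_add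
    (is_derive_mulr (2^-1 * x 0 i0 * y 0 i0) (dt _ _ (is_deriveN dfV)))
    (is_derive_mulr (2^-1 * x 0 i1 * y 0 i1) (dt _ _ dff)))
    (is_derive_mulr (x 0 i2 * y 0 i2) (dt _ _ dtf)))
    (is_derive_mulr (x 0 i3 * y 0 i3) (is_derive_mul (dt _ _ dtf) (dth _ _ dss))).
  move/is_derive_eq; apply; rewrite /GRing.scale /=.
  rewrite -/(coord_t p) -/(coord_theta p); field.
  exact: f0.
- have := is_derive_mulr (2^-1 * (x 0 i0 * y 0 i1 + x 0 i1 * y 0 i0)) (dt _ _ dfV).
  move/is_derive_eq; apply; rewrite /GRing.scale /=.
  rewrite -/(coord_t p) -/(coord_theta p); field.
  exact: f0.
- have := is_derive_sub
    (is_derive_mulr (x 0 i0 * y 0 i2 + x 0 i2 * y 0 i0) (dt _ _ dV))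
    (is_derive_mulr (x 0 i3 * y 0 i3) (dth _ _ dsc)).
  move/is_derive_eq; apply; rewrite /GRing.scale /=.
  rewrite -/(coord_t p) -/(coord_theta p); field.
  exact: t0.
- have := is_derive_add
    (is_derive_mulr (x 0 i0 * y 0 i3 + x 0 i3 * y 0 i0) (dt _ _ dV))
    (is_derive_mulr (x 0 i2 * y 0 i3 + x 0 i3 * y 0 i2) (dth _ _ dcs)).
  (* The derivative of cot is -(s^2 + c^2) / s^2, to be simplified to -1 / s^2. *)
  have cs : c ^+ 2 = 1 - s ^+ 2 by rewrite -(cos2Dsin2 (coord_theta p)) addrK.
  move/is_derive_eq; apply; rewrite /GRing.scale /=.
  rewrite -/(coord_t p) -/(coord_theta p); field: cs.
  by rewrite s0 t0.
Qed.

Hypothesis near_p : \forall q \near p,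
  warped_regular q /\ is_derive (coord_t q) 1 f (f1 (coord_t q)).

(** For constant fields the bracket vanishes, leaving derivatives of the Christoffel term and its
    iterates. The factors are minus the sectional curvatures of the (t, z), mixed and (theta, phi)
    coordinate planes, the sign coming from the convention for R. *)
Lemma Rcurv_warped : Rcurv warped_metric p =
  block_op (warped_diag p) (- f2 / 2) (- f1 t / (2 * t)) (- f1 t / (2 * t))
    (- (1 + f t) / t ^+ 2).
Proof.
have [t0 f0 s0] := p_regular.
apply/funext => x; apply/funext => y; apply/funext => u.
have gammaE a b :
    nabla warped_metric (fun=> a) (nabla warped_metric (fun=> b) (fun=> u)) p =
    warped_gamma_derive a b u + warped_gamma p a (warped_gamma p b u).
  have nE q : warped_regular q -> is_derive (coord_t q) 1 f (f1 (coord_t q)) ->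
      warped_gamma q b u = nabla warped_metric (fun=> b) (fun=> u) q.
    by move=> reg dq; rewrite nabla_warped // derive_cst add0r.
  rewrite nabla_warped // -nE //; congr (_ + _).
  (* The outer derivative sees the inner [nabla] near [p], so its closed form is needed on a
     neighbourhood. *)
  have [_ <-] := is_derive_warped_gamma a b u; apply/esym/near_eq_derive.
  by apply: filterS near_p => q [reg dq]; exact: nE.
rewrite /Rcurv /curvature_field !gammaE nabla_warped // derive_cst.
rewrite /lie_bracket !derive_cst subr0.
have cs : c ^+ 2 = 1 - s ^+ 2 by rewrite -(cos2Dsin2 (coord_theta p)) addrK.
apply/rowP; apply: ord4P; rewrite !mxE /= /block_form /form1 /form2 !mxE /=.
all: by field: cs; rewrite ?t0 ?f0 ?s0.
Qed.

End Curvature.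
End WarpedMetric.

(** * Specialization to f = 2 xi / t - 1 *)

Theorem theorem4p1 (R : realType) (I : set R) (xi : R -> R)
    (I_open : open I) (I_itv : is_interval I)
    (I_gt0 : forall t, I t -> 0 < t)
    (I_interior : forall t, I t -> 0 < 2 * xi t / t - 1)
    (xi_smooth : smooth_on I xi)
    (p : 'rV[R]_4) (pM : bh_domain I p) :
  let g := bh_metric xi in
  let t := coord_t p in
  let xi1 : R := (xi^`())%classic t in
  let xi2 : R := (xi^`(2))%classic t in
  let L1 := (xi t - t * xi1) / t ^+ 3 in
  let L2 := (6 * xi t - 4 * t * xi1 + t ^+ 2 * xi2) / (6 * t ^+ 3) in
  let L3 := (2 * xi t + t ^+ 2 * xi2) / (2 * t ^+ 3) in
  let S2 := tensor2 (ricci g p) in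
  (* (i) *)
  (forall Z X x y, let T := curv_tensor g p Z in
    dot (Rcurv g p) T X x y = L1 * Qten (metric g p) T X x y) /\
  (* (ii) *)
  (forall Z X x y, let T := curv_tensor g p Z in
    dot (Ccurv g p) T X x y = L2 * Qten (metric g p) T X x y) /\
  (* (iii) *)
  (forall Z X x y, let T := curv_tensor g p Z in
    dot (Wcurv g p) T X x y = L2 * Qten (metric g p) T X x y) /\
  (* (iv) *)
  (forall Z X x y, let T := curv_tensor g p Z in
    dot (Kcurv g p) T X x y = L3 * Qten (metric g p) T X x y) /\
  (* (v) *)
  (forall X x y,
    dot (Pcurv g p) S2 X x y = L1 * Qten (metric g p) S2 X x y) /\
  (* (vi) *)
  (forall Z X x y, let T := curv_tensor g p Z in
    dot (Pcurv g p) T X x y =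
      L1 * Qten (metric g p) T X x y - 3^-1 * Qten (ricci g p) T X x y).
Proof.
move=> g t xi1 xi2 L1 L2 L3 S2; have [It th_range] := pM.
pose f (t : R) : R := 2 * xi t / t - 1.
(* [f1] is f' as a function on I, while [f2] is f'' at the single point [t]. *)
pose f1 (t : R) : R := 2 * (t * (xi^`())%classic t - xi t) / t ^+ 2.
pose f2 : R := 2 * (xi2 / t - 2 * xi1 / t ^+ 2 + 2 * xi t / t ^+ 3).
have t0 z : I z -> z != 0 by move/I_gt0/lt0r_neq0.
have did (z : R) : is_derive z 1 (fun t : R => t) 1 by exact: is_derive_id.
have dcst (z c : R) : is_derive z 1 (fun=> c) 0 by exact: is_derive_cst.
have dxi z : I z -> is_derive z 1 xi ((xi^`())%classic z).
  move=> Iz; have := xi_smooth 0%N z Iz; rewrite derive1n0 => /derivableP.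
  by rewrite derive1E.
have dxi1 : is_derive t 1 (xi^`())%classic xi2.
  have := xi_smooth 1%N t It; rewrite derive1n1 => /derivableP.
  by rewrite /xi2 derive1nS derive1n1 derive1E.
have df z : I z -> is_derive z 1 f (f1 z).
  move=> Iz; have := is_derive_sub (is_derive_mul
    (is_derive_mul (dcst z 2) (dxi z Iz)) (is_deriveV (t0 z Iz) (did z))) (dcst z 1).
  move/is_derive_eq; apply; rewrite /f1 /GRing.scale /=.
  by field; exact: t0.
have tV2 : is_derive t 1 (fun t : R => (t ^+ 2)^-1) (- 2 / t ^+ 3).
  have dsq : is_derive t 1 (fun t : R => t ^+ 2) (2 * t).
    by apply: is_derive_eq; rewrite /GRing.scale /=; ring.
  have := is_deriveV (expf_neq0 2 (t0 t It) : (fun t : R => t ^+ 2) t != 0) dsq.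
  move/is_derive_eq; apply; rewrite /GRing.scale /=.
  by field; exact: t0.
have df1 : is_derive t 1 f1 f2.
  have := is_derive_mul (is_derive_mul (dcst t 2)
    (is_derive_sub (is_derive_mul (did t) dxi1) (dxi t It))) tV2.
  move/is_derive_eq; apply; rewrite /f2 /xi1 /=.
  by field; exact: t0.
have regular q : bh_domain I q -> warped_regular f q.
  case=> Iq thq; split; first exact: t0.
    exact/lt0r_neq0/I_interior.
  exact/lt0r_neq0/sin_gt0_pi.
have near_p : \forall q \near p, bh_domain I q.
  apply: filterI.
    apply: (@coord_continuous _ _ _ 0 i0 p); exact: open_nbhs_nbhs.
  apply: (@coord_continuous _ _ _ 0 i2 p [set th | 0 < th < pi]).
  rewrite -set_itvoo; apply: open_nbhs_nbhs; split; first exact: interval_open.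
  by rewrite set_itvoo.
have near_regular : \forall q \near p,
    warped_regular f q /\ is_derive (coord_t q) 1 f (f1 (coord_t q)).
  by apply: filterS near_p => q qM; split; [exact: regular|exact: df qM.1].
have RE : Rcurv g p = _ := Rcurv_warped (regular p pM) (df t It) df1 near_regular.
have gE : g p = diag_mx (warped_diag f p) by [].
have d0 i := warped_diag_neq0 i (regular p pM).
(* The mixed factor of R. *)
have mE : - f1 t / (2 * t) = L1 by rewrite /f1 /L1 /xi1; field; exact: t0.
rewrite -/t mE in RE.
(* The parenthesis is s1 + s2, so this is the mixed factor shared by C and W; with 2 in place of 6
   it becomes that of K. *)
have L2E : L1 - (- f2 / 2 + 2 * L1 + (2 * L1 - (1 + f t) / t ^+ 2)) / 6 = L2.
  by rewrite /L1 /L2 /f /f2; field; exact: t0.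
have L3E : L1 - (- f2 / 2 + 2 * L1 + (2 * L1 - (1 + f t) / t ^+ 2)) / 2 = L3.
  by rewrite /L1 /L3 /f /f2; field; exact: t0.
have RT Z X x y : dot (Rcurv g p) (curv_tensor g p Z) X x y =
    L1 * Qten (metric g p) (curv_tensor g p Z) X x y.
  by rewrite RE (dot_curv_tensor gE d0 RE).
split; [exact: RT|split; [|split; [|split; [|split]]]].
- move=> Z X x y T; rewrite (Ccurv_block gE d0 RE) (dot_curv_tensor gE d0 RE).
  by congr (_ * _); rewrite -L2E; field; exact: t0.
- move=> Z X x y T; rewrite (Wcurv_block gE d0 RE) (dot_curv_tensor gE d0 RE).
  by congr (_ * _); rewrite -L2E; field; exact: t0.
- move=> Z X x y T; rewrite (Kcurv_block gE d0 RE) (dot_curv_tensor gE d0 RE).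
  by congr (_ * _); rewrite -L3E; field; exact: t0.
(* The ascription on [X] selects Z = S, where the term Q(S, S) drops out. *)
- move=> X x y; have := dot_Pcurv gE d0 RE (X : 'I_(curv_arity nS) -> _) x y.
  by rewrite RT /= (Qten_ricci RE) mulr0 subr0.
- by move=> Z X x y T; rewrite (dot_Pcurv gE d0 RE) RT.
Qed.
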